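(* Let $b_n:\mathbb{D}\to\mathbb{D}$, $n\in\mathbb{N}$, be finite Blaschke products such that $b_n(0)=0$ for all $n\in\mathbb{N}$, and assume that $B_n := b_n\circ b_{n-1}\circ\cdots\circ b_1$ converges locally uniformly in $\mathbb{D}$ to some $B:\mathbb{D}\to\mathbb{D}$. Then $B$ is either constant or a Blaschke product.
   Context: $\mathbb{D}=\{z\in\mathbb{C}:|z|<1\}$ is the open unit disc and $\mathbb{N}=\{1,2,3,\dots\}$. A Blaschke product is a function of the form $z\mapsto \alpha z^k\prod_{j}\frac{|z_j|}{z_j}\frac{z_j-z}{1-\overline{z_j}z}$, where $|\alpha|=1$, $k\geq 0$ is an integer, and $(z_j)$ is a finite (possibly empty) or infinite sequence in $\mathbb{D}\setminus\{0\}$ (repetitions allowed) with $\sum_j(1-|z_j|)<+\infty$. It is finite if the sequence $(z_j)$ is finite, in which case its degree is its number of zeros in $\mathbb{D}$ counted with multiplicity. All Blaschke products are understood to be non-constant, i.e. to have at least one zero in $\mathbb{D}$. *)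

(* Defs.v *)
From HB Require Import structures.
From mathcomp Require Import all_boot all_order all_algebra.
From mathcomp Require Import all_classical all_reals all_analysis.
From mathcomp Require Import complex.

Set Implicit Arguments.
Unset Strict Implicit.
Unset Printing Implicit Defensive.

Import Order.TTheory GRing.Theory Num.Theory.
Import numFieldNormedType.Exports.

Local Open Scope classical_set_scope.
Local Open Scope ring_scope.

(* The type [R[i]] does not come with a topology; this gives it the one induced
   by its modulus. As in every numFieldType, the radii of balls are the
   positive elements of [R[i]] itself, that is the positive reals. *)
HB.instance Definition _ (R : rcfType) := NormedModule.copy R[i] R[i]^o.

Definition unit_disc (R : realType) : set R[i] := [set z | `|z| < 1].

(* Functions on the disc are represented by total functions [R[i] -> R[i]] of
   which only the values on [unit_disc] matter: every condition below is
   restricted to the disc. *)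

Definition blaschke_factor (R : realType) (a z : R[i]) : R[i] :=
  `|a| / a * ((a - z) / (1 - a^* * z)).

(* The zeros of a Blaschke product are those of its factor [z ^+ k] at the
   origin, and the terms of the sequence below. *)
Definition finite_blaschke_form (R : realType) (f : R[i] -> R[i]) : Prop :=
  exists (alpha : R[i]) (k : nat) (s : seq R[i]),
    [/\ `|alpha| = 1,
        forall a, a \in s -> unit_disc a /\ a != 0
      & forall z, unit_disc z ->
          f z = alpha * z ^+ k * \prod_(a <- s) blaschke_factor a z].

(* The terms [1 - `|a j|] are nonnegative reals, seen in [R[i]], so that the
   convergence of their series means that their sum is finite. *)
Definition infinite_blaschke_form (R : realType) (f : R[i] -> R[i]) : Prop :=
  exists (alpha : R[i]) (k : nat) (a : nat -> R[i]) (P : R[i] -> R[i]),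
    [/\ `|alpha| = 1,
        forall j, unit_disc (a j) /\ a j != 0,
        cvgn (series (fun j => 1 - `|a j|)),
        forall z, unit_disc z ->
          (fun n => \prod_(0 <= j < n) blaschke_factor (a j) z) @ \oo --> P z
      & forall z, unit_disc z -> f z = alpha * z ^+ k * P z].

Definition has_zero_in_disc (R : realType) (f : R[i] -> R[i]) : Prop :=
  exists2 z, unit_disc z & f z = 0.

Definition finite_blaschke (R : realType) (f : R[i] -> R[i]) : Prop :=
  finite_blaschke_form f /\ has_zero_in_disc f.

Definition blaschke (R : realType) (f : R[i] -> R[i]) : Prop :=
  (finite_blaschke_form f \/ infinite_blaschke_form f) /\ has_zero_in_disc f.

Definition constant_on (T U : Type) (A : set T) (f : T -> U) : Prop :=
  exists c, forall x, A x -> f x = c.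

Definition locally_uniform_cvg (T : topologicalType) (V : uniformType)
    (A : set T) (f : nat -> T -> V) (g : T -> V) : Prop :=
  forall x, A x ->
    exists2 U, nbhs x U & {uniform U `&` A, f @ \oo --> g}.

(* [left_comp b n] is [b n \o ... \o b 1]; the term [b 0] is not used. *)
Fixpoint left_comp (T : Type) (b : nat -> T -> T) (n : nat) : T -> T :=
  if n is m.+1 then b m.+1 \o left_comp b m else id.

(* Main.v *)
Require Import Defs.
From mathcomp Require Import all_boot all_order all_algebra.
From mathcomp Require Import all_classical all_reals all_analysis.
From mathcomp Require Import complex ring.

Set Implicit Arguments.
Unset Strict Implicit.
Unset Printing Implicit Defensive.

Import Order.TTheory GRing.Theory Num.Theory.
Import numFieldNormedType.Exports.

Local Open Scope classical_set_scope.
Local Open Scope ring_scope.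

(** Write [B_n = b_n \o ... \o b_1]. Since [b_(n+1)] vanishes at the origin, it
    is [w * g w] for a finite product [g] of Moebius factors and a unimodular
    constant, so [B_(n+1) = B_n * (g \o B_n)]. Finite Blaschke products,
    unimodular constants included, are closed under composition
    ([mobius_product_comp]); hence the quotients [g \o B_n] are such products,
    and [B_n] arises by multiplying in more and more Blaschke factors:
    [B_n z = A_n * z ^+ K_n * \prod_(a <- S_n) blaschke_factor a z], where
    [|A_n| = 1], [K_n] is nondecreasing and [S_n] is a prefix of [S_(n+1)]
    ([left_comp_chain]).

    From there the argument is pointwise ([chain_limit]). If [B] is not
    identically zero, fix [z0] with [B z0 != 0]. As [|B_n z0|] decreases to
    [|B z0| > 0], the product of the moduli of all the factors at [z0] stays away
    from zero. This forces [K_n] to be eventually constant and the zeros to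
    satisfy the Blaschke condition ([blaschke_condition]); by absolute
    convergence the infinite product then has a limit at every point of the
    disc ([blaschke_product_cvg]). What may still oscillate is the constant
    [A_n], but at [z0] both [B_n] and the product of the factors converge to
    nonzero limits, so [A_n] converges too ([unimodular_multiple_limit]) and [B]
    is a unimodular multiple of the product. *)

(** * Composition of finite products of Moebius factors *)

Lemma horner_ext_nonzero (C : numDomainType) (p q : {poly C}) :
  (forall x, x != 0 -> p.[x] = q.[x]) -> p = q.
Proof.
move=> pq; apply/eqP; rewrite -subr_eq0; apply/negPn/negP => nz.
have := @max_poly_roots C (p - q) [seq k.+1%:R | k <- iota 0 (size (p - q))] nz.
rewrite size_map size_iota ltnn => H; suff: false by []; apply: H.
  apply/allP => _ /mapP[k _ ->].
  by rewrite rootE hornerD hornerN pq ?subrr // pnatr_eq0.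
rewrite map_inj_uniq ?iota_uniq // => i j /eqP.
by rewrite eqr_nat eqSS => /eqP.
Qed.

Section Mobius.
Variable C : numClosedFieldType.
Implicit Types (a b z : C) (s : seq C).

(** The sign is opposite to that of [blaschke_factor], and there is no
    normalizing constant, so that the origin needs no separate treatment:
    [mobius 0] is the identity. *)
Definition mobius a z : C := (z - a) / (1 - a^* * z).

Lemma mobius0 (z : C) : mobius 0 z = z.
Proof. by rewrite /mobius subr0 rmorph0 mul0r subr0 divr1. Qed.

Lemma sqr_norm_sub_conj a z :
  `|1 - a^* * z| ^+ 2 - `|z - a| ^+ 2 = (1 - `|a| ^+ 2) * (1 - `|z| ^+ 2).
Proof. rewrite !normCK !rmorphB !rmorphM rmorph1 /= conjCK; ring. Qed.

(** Outside the disc, [mobius a] has modulus at least one; cross-multiplied to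
    cover a vanishing denominator. *)
Lemma norm_conj_le_norm_sub a z : `|a| < 1 -> 1 <= `|z| ->
  `|1 - a^* * z| <= `|z - a|.
Proof.
move=> a1 z1; rewrite -(@ler_pXn2r _ 2) ?nnegrE //.
rewrite -subr_le0 sqr_norm_sub_conj mulr_ge0_le0 //.
  by rewrite subr_ge0 expr_le1 // ltW.
by rewrite subr_le0 expr_ge1.
Qed.

Lemma conj_den_neq0 a z : `|a| < 1 -> `|z| < 1 -> 1 - a^* * z != 0.
Proof.
move=> a1 z1; rewrite subr_eq0; apply/eqP => /(congr1 Num.norm) /eqP.
rewrite normr1 normrM norm_conjC eq_sym lt_eqF //.
by rewrite mulr_ilt1.
Qed.

(** [num_poly s] and [den_poly s] are the numerator and the denominator of
    [\prod_(a <- s) mobius a z]. *)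
Definition num_poly s : {poly C} := \prod_(a <- s) ('X - a%:P).
Definition den_poly s : {poly C} := \prod_(a <- s) (1 - a^* *: 'X).

Lemma horner_num s z : (num_poly s).[z] = \prod_(a <- s) (z - a).
Proof. by rewrite horner_prod; under eq_bigr do rewrite hornerXsubC. Qed.

Lemma horner_den s z : (den_poly s).[z] = \prod_(a <- s) (1 - a^* * z).
Proof.
rewrite horner_prod.
by under eq_bigr do rewrite hornerD hornerN hornerZ hornerX hornerC.
Qed.

Lemma size_num s : size (num_poly s) = (size s).+1.
Proof. exact: size_prod_XsubC. Qed.

Lemma size_den s : (size (den_poly s) <= (size s).+1)%N.
Proof.
elim: s => [|a s IH]; first by rewrite /den_poly big_nil size_poly1.
have sza : (size (1 - a^* *: 'X : {poly C})%R <= 2)%N.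
  rewrite (leq_trans (size_polyD _ _)) // geq_max size_poly1 size_polyN /=.
  by rewrite (leq_trans (size_scale_leq _ _)) // size_polyX.
rewrite /den_poly big_cons (leq_trans (size_polyMleq _ _)) //=.
by rewrite -subn1; apply: leq_trans (leq_sub2r 1 (leq_add sza IH)) _;
  rewrite subn1.
Qed.

(** Numerator and denominator are exchanged by the reversal of a polynomial of
    degree [size s] with conjugate coefficients. It is used through evaluation at
    [z != 0] and at the mirror image [1 / z^*] in the unit circle. *)
Lemma num_reflect s z : z != 0 ->
  (num_poly s).[z] = z ^+ size s * ((den_poly s).[(z^*)^-1])^*.
Proof.
move=> z0; rewrite horner_num horner_den rmorph_prod /=.
elim: s => [|a s IH]; first by rewrite !big_nil mulr1.
rewrite !big_cons IH /= exprS rmorphB rmorph1 rmorphM fmorphV /= !conjCK.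
by field.
Qed.

Lemma den_reflect s z : z != 0 ->
  (den_poly s).[z] = z ^+ size s * ((num_poly s).[(z^*)^-1])^*.
Proof.
move=> z0; rewrite horner_num horner_den rmorph_prod /=.
elim: s => [|a s IH]; first by rewrite !big_nil mulr1.
rewrite !big_cons IH /= exprS rmorphB /= fmorphV /= conjCK.
by field.
Qed.

Lemma norm_den_le_num s z : {in s, forall a, `|a| < 1} -> 1 <= `|z| ->
  `|(den_poly s).[z]| <= `|(num_poly s).[z]| /\ (num_poly s).[z] != 0.
Proof.
move=> s1 z1; rewrite horner_num horner_den !normr_prod; split.
  rewrite !big_seq; apply: ler_prod => a /s1 a1.
  by rewrite normr_ge0 norm_conj_le_norm_sub.
rewrite prodf_seq_neq0; apply/allP => a /s1 a1 /=.
rewrite subr_eq0; apply: contraTneq z1 => ->; rewrite lt_geF //; exact: a1.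
Qed.

(** With [p / q] the finite product, [mobius a \o (p / q) = N / D] for
    [N = p - a q] and [D = q - a^* p]. On and outside the unit circle
    [|q| <= |p|], so [N] cannot vanish there and factors as
    [l * \prod_(r <- s') ('X - r)] with all [r] in the disc. Reflection in the
    unit circle carries [N] to [D] up to a unimodular constant, hence [D] is the
    corresponding product of the [1 - r^* 'X]. *)
Lemma mobius_prod_comp c a s : `|c| = 1 -> `|a| < 1 ->
    {in s, forall b, `|b| < 1} ->
  exists c' s', [/\ `|c'| = 1, {in s', forall b, `|b| < 1} &
    forall z, `|z| < 1 -> mobius a (c * \prod_(b <- s) mobius b z) =
      c' * \prod_(b <- s') mobius b z].
Proof.
move=> c1 a1 s1.
have c0 : c != 0 by rewrite -normr_eq0 c1 oner_eq0.
pose N := c *: num_poly s - a *: den_poly s.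
pose D := den_poly s - (a^* * c) *: num_poly s.
have NE z : N.[z] = c * (num_poly s).[z] - a * (den_poly s).[z].
  by rewrite hornerD hornerN !hornerZ.
have DE z : D.[z] = (den_poly s).[z] - a^* * c * (num_poly s).[z].
  by rewrite hornerD hornerN !hornerZ.
have Nout z : 1 <= `|z| -> N.[z] != 0.
  move=> z1; have [le n0] := norm_den_le_num s1 z1.
  rewrite NE subr_eq0; apply/eqP => /(congr1 Num.norm)/eqP.
  rewrite !normrM c1 mul1r gt_eqF //.
  apply: (@le_lt_trans _ _ (`|a| * `|(num_poly s).[z]|)).
    by rewrite ler_wpM2l.
  by rewrite gtr_pMl // normr_gt0.
have N0 : N != 0.
  by apply: contraTneq (Nout 1 _) => [->|]; rewrite ?horner0 ?eqxx ?normr1.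
have [s' Nfact] := closed_field_poly_normal N.
set l := lead_coef N in Nfact.
have l0 : l != 0 by rewrite lead_coef_eq0.
have NfactE z : N.[z] = l * (num_poly s').[z] by rewrite {1}Nfact hornerZ.
have s'1 : {in s', forall b, `|b| < 1}.
  move=> b bs'; have Nb : N.[b] = 0.
    rewrite NfactE; apply/eqP.
    by rewrite mulf_eq0 -rootE root_prod_XsubC bs' orbT.
  rewrite real_ltNge ?normr_real //; apply/negP => /Nout.
  by rewrite Nb eqxx.
have szN : size N = (size s').+1 by rewrite Nfact size_scale // size_num.
have szle : (size s' <= size s)%N.
  rewrite -ltnS -szN (leq_trans (size_polyD _ _)) // geq_max size_polyN.
  by rewrite size_scale // size_num leqnn (leq_trans (size_scale_leq _ _)) ?size_den.
have cc : c * c^* = 1 by rewrite -normCK c1 expr1n.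
(* A priori [N] may have degree less than [size s]; the reflection then leaves a
   power of ['X] in [D], which [D0] excludes below. *)
have Dfact : D = (c * l^*) *: ('X^(size s - size s') * den_poly s').
  apply: horner_ext_nonzero => z z0.
  rewrite hornerZ hornerM hornerXn DE (den_reflect s z0) (num_reflect s z0).
  rewrite (den_reflect s' z0).
  (* Both sides are the reflection of [N], times [c]. *)
  rewrite [X in _ = X](_ : _ = z ^+ size s * c * (l * (num_poly s').[(z^*)^-1])^*).
    rewrite -NfactE NE rmorphB !rmorphM /=.
    transitivity (z ^+ size s * (c * c^*) * (((num_poly s).[(z^*)^-1])^*) -
        a^* * c * (z ^+ size s * ((den_poly s).[(z^*)^-1])^*)); last by ring.
    by rewrite cc mulr1.
  by rewrite rmorphM /= -{2}(subnK szle) exprD; ring.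
have D0 : D.[0] != 0.
  rewrite DE horner_den horner_num.
  under eq_bigr do rewrite mulr0 subr0.
  rewrite big1 // subr_eq0; apply/eqP => /(congr1 Num.norm)/eqP.
  rewrite normr1 !normrM norm_conjC c1 mulr1 eq_sym lt_eqF //.
  apply: (@le_lt_trans _ _ `|a|) => //.
  rewrite ler_piMr // normr_prod big_seq; apply: prodr_ile1 => b /s1 b1.
  by rewrite normr_ge0 sub0r normrN ltW.
have szeq : size s = size s'.
  apply/eqP; rewrite eqn_leq szle andbT; rewrite leqNgt -subn_gt0.
  apply/negP => gt; move/negP: D0; apply; apply/eqP.
  by rewrite Dfact hornerZ hornerM hornerXn expr0n gtn_eqF // mul0r mulr0.
exists (l / (c * l^*)), s'; split=> //.
  by rewrite normrM normfV normrM c1 mul1r norm_conjC divff // normr_eq0.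
move=> z z1.
have q0 : \prod_(b <- s) (1 - b^* * z) != 0.
  by rewrite prodf_seq_neq0; apply/allP => b /s1 b1 /=; apply: conj_den_neq0.
have qs : \prod_(b <- s) mobius b z = (num_poly s).[z] / (den_poly s).[z].
  by rewrite horner_num horner_den prodf_div.
have qs' : \prod_(b <- s') mobius b z = (num_poly s').[z] / (den_poly s').[z].
  by rewrite horner_num horner_den prodf_div.
have := NE z; rewrite NfactE => NE'.
have := DE z; rewrite Dfact szeq subnn expr0 mul1r hornerZ => DE'.
rewrite qs qs' mulf_div NE' DE' /mobius -horner_den in q0 *.
set p := (num_poly s).[z]; set q := (den_poly s).[z] in q0 *.
have -> : c * (p / q) - a = (c * p - a * q) / q by field.
have -> : 1 - a^* * (c * (p / q)) = (q - a^* * c * p) / q by field.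
by rewrite -mulf_div divff ?mulr1 // invr_eq0.
Qed.

(** The same functions as in [finite_blaschke_form]
    ([finite_blaschke_form_mobius_product], [mobius_product_finite_blaschke_form]),
    with the zeros at the origin listed among the others. Unimodular constants
    are included: the quotients of consecutive compositions may be constant. *)
Definition mobius_product (f : C -> C) := exists c s, [/\ `|c| = 1,
  {in s, forall a : C, `|a| < 1} &
  forall z, `|z| < 1 -> f z = c * \prod_(a <- s) mobius a z].

Lemma mobius_productM (f g : C -> C) :
  mobius_product f -> mobius_product g -> mobius_product (fun z => f z * g z).
Proof.
move=> [c [s [c1 s1 fE]]] [d [t [d1 t1 gE]]].
exists (c * d), (s ++ t); split; first by rewrite normrM c1 mul1r.
  by move=> a; rewrite mem_cat => /orP[/s1|/t1].
by move=> z z1; rewrite fE // gE // big_cat mulrACA.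
Qed.

Lemma mobius_product_comp (b f : C -> C) : (forall z, `|z| < 1 -> `|f z| < 1) ->
  mobius_product b -> mobius_product f -> mobius_product (b \o f).
Proof.
move=> f_disc [c [s [c1 s1 bE]]] [d [t [d1 t1 fE]]].
suff [c' [s' [c'1 s'1 E]]] :
    mobius_product (fun z => c * \prod_(a <- s) mobius a (f z)).
  by exists c', s'; split=> // z z1; rewrite -E //= bE // f_disc.
elim: s s1 {bE} => [_|a s IH s1].
  by exists c, [::]; split => // z z1; rewrite !big_nil.
have [e [u [e1 u1 aE]]] := mobius_prod_comp d1 (s1 a (mem_head _ _)) t1.
have aP : mobius_product (fun z => mobius a (f z)).
  by exists e, u; split => // z z1; rewrite fE // aE.
have sP := IH (fun b bs => s1 b (mem_behead (s := a :: s) bs)).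
have [c' [s' [c'1 s'1 E]]] := mobius_productM aP sP.
by exists c', s'; split=> // z z1; rewrite -E // big_cons mulrCA.
Qed.

Lemma mobius_product_factor0 (b : C -> C) : mobius_product b -> b 0 = 0 ->
  exists2 g, mobius_product g & forall z, `|z| < 1 -> b z = z * g z.
Proof.
move=> [c [s [c1 s1 bE]]] b0.
have s0 : 0 \in s.
  have : b 0 == 0 by apply/eqP.
  rewrite bE ?normr0 // mulf_eq0 -normr_eq0 c1 oner_eq0 /= prodf_seq_eq0.
  move=> /hasP[a as_] /=.
  by rewrite /mobius mulr0 subr0 invr1 mulr1 sub0r oppr_eq0 => /eqP <-.
exists (fun z => c * \prod_(a <- rem 0 s) mobius a z).
  by exists c, (rem 0 s); split=> // a /mem_rem/s1.
move=> z z1; rewrite bE // (perm_big _ (perm_to_rem s0)) big_cons.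
by rewrite mobius0 mulrCA.
Qed.

End Mobius.

Section Normalization.
Variable R : realType.

Lemma blaschke_factorE (a z : R[i]) : blaschke_factor a z = - (`|a| / a) * mobius a z.
Proof. by rewrite /blaschke_factor /mobius -opprB !mulNr mulrN. Qed.

Lemma norm_unit_factor (a : R[i]) : a != 0 -> `|- (`|a| / a)| = 1.
Proof. by move=> a0; rewrite normrN normrM normfV normr_id divff ?normr_eq0. Qed.

Lemma prod_blaschke_factor (s : seq R[i]) z :
  \prod_(a <- s) blaschke_factor a z =
  \prod_(a <- s) (- (`|a| / a)) * \prod_(a <- s) mobius a z.
Proof.
by rewrite -big_split /=; apply: eq_bigr => a _; rewrite blaschke_factorE.
Qed.

Lemma norm_prod_unit_factor (s : seq R[i]) : {in s, forall a, a != 0} ->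
  `|\prod_(a <- s) (- (`|a| / a))| = 1.
Proof.
by move=> s0; rewrite normr_prod big_seq big1 // => a /s0; exact: norm_unit_factor.
Qed.

Lemma finite_blaschke_form_mobius_product (f : R[i] -> R[i]) :
  finite_blaschke_form f -> mobius_product f.
Proof.
move=> [c [k [s [c1 s1 fE]]]].
exists (c * \prod_(a <- s) (- (`|a| / a))), (nseq k 0 ++ s); split.
- by rewrite normrM c1 mul1r norm_prod_unit_factor // => a /s1[].
- move=> a; rewrite mem_cat mem_nseq => /orP[/andP[_ /eqP ->]|/s1[]//].
  by rewrite normr0.
- move=> z z1; rewrite fE // big_cat /= prod_blaschke_factor big_nseq mobius0.
  by rewrite iter_mulr_1; ring.
Qed.

Lemma mobius_product_finite_blaschke_form (f : R[i] -> R[i]) :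
  mobius_product f -> finite_blaschke_form f.
Proof.
move=> [c [s [c1 s1 fE]]].
pose t := [seq a <- s | a != 0].
have t0 : {in t, forall a, a != 0} by move=> a; rewrite mem_filter => /andP[].
have u1 := norm_prod_unit_factor t0.
set u := \prod_(a <- t) _ in u1.
have u0 : u != 0 by rewrite -normr_eq0 u1 oner_eq0.
exists (c / u), (count (pred1 0) s), t; split.
- by rewrite normrM normfV c1 u1 divr1.
- by move=> a; rewrite mem_filter => /andP[a0 /s1].
move=> z z1; rewrite fE // prod_blaschke_factor -/u.
rewrite (bigID (pred1 0)) /= -(big_filter s (fun a => a != 0)) -/t.
have -> : \prod_(a <- s | a == 0) mobius a z = z ^+ count (pred1 0) s.
  under eq_bigr => a /eqP -> do rewrite mobius0.
  by rewrite big_const_seq iter_mulr_1.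
by field.
Qed.
End Normalization.

(** * Limits of sequences *)

(** The next lemmas are limit rules specialized to sequences in an abstract
    [numFieldType]: instantiating them at [R[i]] identifies its topology with the
    one of the field in a single conversion. *)
Lemma cvgn_mul (K : numFieldType) (u v : nat -> K) (a b : K) :
  u @ \oo --> a -> v @ \oo --> b -> (fun n => u n * v n) @ \oo --> a * b.
Proof. exact: cvgM. Qed.

Lemma cvgn_inv (K : numFieldType) (u : nat -> K) (a : K) :
  a != 0 -> u @ \oo --> a -> (fun n => (u n)^-1) @ \oo --> a^-1.
Proof. exact: cvgV. Qed.

Lemma cvgn_unique (K : numFieldType) (u : nat -> K) (a b : K) :
  u @ \oo --> a -> u @ \oo --> b -> a = b.
Proof. by move=> ua ub; apply: (cvg_unique (@norm_hausdorff K K^o) ua ub). Qed.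

Lemma cvgn_normr (K : numFieldType) (u : nat -> K) (a : K) :
  u @ \oo --> a -> (fun n => `|u n|) @ \oo --> `|a|.
Proof. exact: cvg_norm. Qed.

Lemma cvgn_const (K : numFieldType) (a : K) : (fun=> a : K) @ \oo --> a.
Proof. exact: cvg_cst. Qed.

Lemma cvgn_eventually_eq (K : numFieldType) (u v : nat -> K) N (a : K) :
  (forall n, (N <= n)%N -> u n = v n) -> v @ \oo --> a -> u @ \oo --> a.
Proof.
move=> uv; apply: cvg_trans; apply: near_eq_cvg.
by exists N => // n /= Nn; rewrite uv.
Qed.

(** The sharp bound is [|a|]; half of it follows directly from the definition of
    the limit and suffices below. *)
Lemma cvgn_norm_lower_bound (K : numFieldType) (u : nat -> K) (a : K) :
    u @ \oo --> a -> (forall n, `|u n.+1| <= `|u n|) ->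
  forall n, `|a| / 2 <= `|u n|.
Proof.
move=> ua uS n.
have [->|a0] := eqVneq a 0; first by rewrite normr0 mul0r.
have h0 : 0 < `|a| / 2 by rewrite divr_gt0 ?normr_gt0.
move/cvgrPdist_lt : ua => /(_ _ h0)[N _ Nu].
have le : `|u (maxn n N)| <= `|u n|.
  apply: (@homo_leq _ (fun n => `|u n|) (fun x y => y <= x)) => //.
  - by move=> y x z xy yz; apply: le_trans yz xy.
  - exact: leq_maxl.
apply: le_trans le; have /ltW := Nu (maxn n N) (leq_maxr n N) => dist.
have := ler_normD (a - u (maxn n N)) (u (maxn n N)); rewrite subrK => tri.
rewrite -(lerD2l (`|a| / 2)) -splitr (le_trans tri) // lerD2r //.
Qed.

(** The constants converge because both sides do at [z0], where the limits are
    nonzero: [|G z0| = |B z0|] as the constants have modulus one. *)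
Lemma unimodular_multiple_limit (K : numFieldType) (D : set K) (A : nat -> K)
    (g : nat -> K -> K) (G B : K -> K) z0 :
    (forall n, `|A n| = 1) -> D z0 -> B z0 != 0 ->
    (forall z, D z -> g^~ z @ \oo --> G z) ->
    (forall z, D z -> (fun n => A n * g n z) @ \oo --> B z) ->
  exists2 alpha, `|alpha| = 1 & forall z, D z -> B z = alpha * G z.
Proof.
move=> A1 Dz0 B0 gG fB.
have GB : `|G z0| = `|B z0|.
  apply: (@cvgn_unique _ (fun n => `|g n z0|)); first exact/cvgn_normr/gG.
  apply: (@cvgn_eventually_eq _ _ (fun n => `|A n * g n z0|) 0%N).
    by move=> n _; rewrite normrM A1 mul1r.
  exact/cvgn_normr/fB.
have G0 : G z0 != 0 by rewrite -normr_eq0 GB normr_eq0.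
exists (B z0 / G z0); first by rewrite normrM normfV GB divff ?normr_eq0.
have Acvg : A @ \oo --> B z0 / G z0.
  have [N _ NP] : \forall n \near \oo, g n z0 != 0.
    have h0 : 0 < `|G z0| by rewrite normr_gt0.
    have := gG _ Dz0 => /cvgrPdist_lt/(_ _ h0).
    apply: filterS => n; apply: contraTneq => ->.
    by rewrite subr0 ltxx.
  apply: (@cvgn_eventually_eq _ _ (fun n => (A n * g n z0) * (g n z0)^-1) N).
    by move=> n /NP nz; rewrite mulfK.
  by apply: cvgn_mul; [exact: fB|apply: cvgn_inv => //; exact: gG].
move=> z Dz; apply: (cvgn_unique (fB z Dz)).
by apply: cvgn_mul => //; exact: gG.
Qed.

Lemma real_bounded_variation_cvg (R : realType) (v : nat -> R) (M : R) :
  (forall n, \sum_(0 <= k < n) `|v k.+1 - v k| <= M) -> cvgn v.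
Proof.
move=> bv.
have cs : cvgn (series (telescope v)).
  apply: normed_cvg; apply: nondecreasing_is_cvgn.
    by apply: nondecreasing_series => n _ _; exact: normr_ge0.
  by exists M => _ [n _ <-]; exact: bv.
have -> : v = (fun n => v 0%N + series (telescope v) n).
  by apply/funext => n; rewrite -eq_sum_telescope.
by apply: is_cvgD => //; exact: is_cvg_cst.
Qed.

Lemma norm_Re_le (R : realType) (z : R[i]) : real_complex R `|complex.Re z| <= `|z|.
Proof.
rewrite normc_def lecR -sqrtr_sqr ler_sqrt ?addr_ge0 ?sqr_ge0 //.
by rewrite lerDl sqr_ge0.
Qed.

Lemma norm_Im_le (R : realType) (z : R[i]) : real_complex R `|complex.Im z| <= `|z|.
Proof.
rewrite normc_def lecR -sqrtr_sqr ler_sqrt ?addr_ge0 ?sqr_ge0 //.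
by rewrite lerDr sqr_ge0.
Qed.

Lemma norm_le_Re_Im (R : realType) (z : R[i]) :
  `|z| <= real_complex R (`|complex.Re z| + `|complex.Im z|).
Proof.
rewrite normc_def lecR -[leRHS]ger0_norm ?addr_ge0 // -sqrtr_sqr.
rewrite ler_sqrt ?sqr_ge0 //.
rewrite sqrrD !real_normK ?num_real // addrAC lerDl mulrn_wge0 // mulr_ge0.
Qed.

(** The form of completeness used for both the series of the Blaschke condition
    and the Blaschke product; it reduces to real and imaginary parts. *)
Lemma complex_bounded_variation_cvg (R : realType) (w : nat -> R[i]) (M : R[i]) :
  (forall n, \sum_(0 <= k < n) `|w k.+1 - w k| <= M) ->
  exists l : R[i], w @ \oo --> l.
Proof.
move=> bv.
have part (p : {additive R[i] -> R}) :
    (forall z, real_complex R `|p z| <= `|z|) -> cvgn (p \o w).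
  move=> pz; apply: (@real_bounded_variation_cvg _ _ (complex.Re M)) => n.
  have : real_complex R (\sum_(0 <= k < n) `|p (w k.+1) - p (w k)|) <= M.
    apply: le_trans (bv n); rewrite rmorph_sum /=.
    by apply: ler_sum => k _; rewrite -raddfB.
  by rewrite lecE => /andP[].
(* [Re] and [Im] are additive on [Rcomplex R], an alias of [R[i]]. *)
pose re : {additive R[i] -> R} := @complex.Re R : {additive Rcomplex R -> R}.
pose im : {additive R[i] -> R} := @complex.Im R : {additive Rcomplex R -> R}.
have /cvg_ex[x wx] := part re (@norm_Re_le R).
have /cvg_ex[y wy] := part im (@norm_Im_le R).
exists (Complex x y).
apply/cvgrPdist_lt => e e0.
have := e0; rewrite ltcE /= => /andP[/eqP e2 e1].
have {e2} -> : e = real_complex R (complex.Re e) by case: e e2 {e0 e1} => ? ? /= ->.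
have h0 : 0 < complex.Re e / 2 by rewrite divr_gt0.
move/cvgrPdist_lt : wx => /(_ _ h0) wx.
move/cvgrPdist_lt : wy => /(_ _ h0) wy.
near=> n.
apply: le_lt_trans (norm_le_Re_Im _) _; rewrite ltcR [ltRHS]splitr.
have hx : `|x - complex.Re (w n)| < complex.Re e / 2 by near: n.
have hy : `|y - complex.Im (w n)| < complex.Re e / 2 by near: n.
case: (w n) hx hy => wn1 wn2 /= hx hy; exact: ltrD.
Unshelve. all: by end_near. Qed.

(** * Size of a Blaschke factor and of its zero *)

Section Factor.
Variables (R : realType) (a z : R[i]).
Hypotheses (a1 : `|a| < 1) (a0 : a != 0) (z1 : `|z| < 1).

Lemma norm_blaschke_factor : `|blaschke_factor a z| = `|mobius a z|.
Proof. by rewrite blaschke_factorE normrM norm_unit_factor // mul1r. Qed.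

Lemma one_sub_sqr_norm_mobius :
  1 - `|mobius a z| ^+ 2 =
    (1 - `|a| ^+ 2) * (1 - `|z| ^+ 2) / `|1 - a^* * z| ^+ 2.
Proof.
have d0 : `|1 - a^* * z| != 0 by rewrite normr_eq0 conj_den_neq0.
rewrite -sqr_norm_sub_conj /mobius normrM normfV; field; exact: d0.
Qed.

Lemma norm_mobius_le1 : `|mobius a z| <= 1.
Proof.
rewrite -(@expr_le1 _ 2) // -subr_ge0 one_sub_sqr_norm_mobius.
by rewrite divr_ge0 ?exprn_ge0 // mulr_ge0 // subr_ge0 expr_le1 // ltW.
Qed.

(** At a fixed [z], a factor close to modulus one has its zero close to the unit
    circle: this is what turns a lower bound on the product into the Blaschke
    condition. *)
Lemma one_sub_norm_zero_le :
  (1 - `|a|) * ((1 - `|z|) / 4) <= 1 - `|blaschke_factor a z| ^+ 2.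
Proof.
have sq (x : R[i]) : `|x| < 1 -> 0 <= 1 - `|x| /\ 1 - `|x| <= 1 - `|x| ^+ 2.
  move=> x1; split; first by rewrite subr_ge0 ltW.
  by rewrite lerD2l lerN2 expr2 ler_piMl // ltW.
have [a2 a3] := sq _ a1; have [z2 z3] := sq _ z1.
rewrite norm_blaschke_factor one_sub_sqr_norm_mobius mulrA.
have d0 : 0 < `|1 - a^* * z| by rewrite normr_gt0 conj_den_neq0.
apply: ler_pM; rewrite ?mulr_ge0 ?invr_ge0 //; first exact: ler_pM.
rewrite lef_pV2 ?posrE ?exprn_gt0 //.
have -> : 4 = 2 ^+ 2 :> R[i] by ring.
rewrite lerXn2r ?nnegrE //.
rewrite (le_trans (ler_normB _ _)) // normr1 normrM norm_conjC lerD2l.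
by rewrite mulr_ile1 // ltW.
Qed.

(** Conversely, zeros close to the unit circle give factors close to one: the
    normalizing constant [|a| / a] makes [1 - |a|] split off from
    [1 - blaschke_factor a z]. *)
Lemma norm_one_sub_blaschke_factor_le :
  `|1 - blaschke_factor a z| <= (1 - `|a|) * (2 / (1 - `|z|)).
Proof.
have d0 := conj_den_neq0 a1 z1.
have -> : 1 - blaschke_factor a z =
    (1 - `|a|) * (a + `|a| * z) / (a * (1 - a^* * z)).
  rewrite /blaschke_factor.
  have h : `|a| ^+ 2 = a * a^* by rewrite normCK.
  transitivity ((a * (1 - a^* * z) - `|a| * (a - z)) / (a * (1 - a^* * z))).
    by field; rewrite d0 a0.
  congr (_ / _).
  transitivity (a - `|a| ^+ 2 * z - `|a| * (a - z)); last by ring.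
  by rewrite h; ring.
have na0 : 0 < `|a| by rewrite normr_gt0.
have za : 0 < 1 - `|z| by rewrite subr_gt0.
have az : 0 < 1 - `|a| by rewrite subr_gt0.
rewrite !normrM normfV normrM -mulrA.
have -> : `|1 - `|a| | = 1 - `|a| by rewrite ger0_norm // subr_ge0 ltW.
rewrite ler_wpM2l ?(ltW az) //.
have nd0 : 0 < `|1 - a^* * z| by rewrite normr_gt0.
rewrite invfM mulrA; apply: ler_pM; rewrite ?invr_ge0 ?mulr_ge0 //.
  rewrite ler_pdivrMr // (le_trans (ler_normD _ _)) // normrM normr_id.
  by rewrite mulr2n mulrDl mul1r lerD2l ler_piMr // ltW.
rewrite lef_pV2 ?posrE // lerBlDr -{1}[1](@normr1 R[i]).
rewrite -{1}[1](subrK (a^* * z)) (le_trans (ler_normD _ _)) // lerD2l.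
by rewrite normrM norm_conjC ler_piMl // ltW.
Qed.
End Factor.

Lemma norm_blaschke_factor_le1 (R : realType) (a z : R[i]) :
  @unit_disc R a -> a != 0 -> @unit_disc R z -> `|blaschke_factor a z| <= 1.
Proof.
by move=> a1 a0 z1; rewrite norm_blaschke_factor //; apply: norm_mobius_le1.
Qed.

Lemma prod_norm_blaschke_factor_le1 (R : realType) (s : seq R[i]) z :
  @unit_disc R z ->
  (forall a, a \in s -> unit_disc a /\ a != 0) ->
  \prod_(a <- s) `|blaschke_factor a z| <= 1.
Proof.
move=> z1 s1; rewrite big_seq prodr_ile1 // => a /s1[a1 a0].
by rewrite normr_ge0 norm_blaschke_factor_le1.
Qed.

(** Multiply [(1 - y) * (1 + y) <= 1] over the factors and expand
    [\prod (1 + y)]. It bounds [\sum y] by the inverse of [\prod (1 - y)], and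
    for constant [y] it is a quantitative form of the decay of a geometric
    sequence. *)
Lemma prod_one_sub_mul_le (T : numDomainType) (y : nat -> T) n :
  (forall j, 0 <= y j <= 1) ->
  (\prod_(0 <= j < n) (1 - y j)) * (1 + \sum_(0 <= j < n) y j) <= 1.
Proof.
move=> y01; elim: n => [|n IH]; first by rewrite !big_geq // addr0 mulr1.
rewrite !big_nat_recr //=; apply: le_trans IH.
rewrite -mulrA ler_wpM2l //.
  by apply: prodr_ge0 => j _; rewrite subr_ge0; case/andP: (y01 j).
have /andP[y0 y1] := y01 n.
set S := \sum_(_ <= _ < _) _; rewrite -subr_ge0.
have -> : 1 + S - (1 - y n) * (1 + (S + y n)) = y n * S + y n * y n by ring.
by rewrite addr_ge0 ?mulr_ge0 // sumr_ge0 // => j _; case/andP: (y01 j).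
Qed.

(** * Infinite Blaschke products *)

Section InfiniteProduct.
Variables (R : realType) (a : nat -> R[i]).
Hypothesis a1 : forall j, unit_disc (a j) /\ a j != 0.
Let P z m := \prod_(0 <= j < m) blaschke_factor (a j) z.

Lemma norm_partial_product_le z m p : @unit_disc R z -> (m <= p)%N ->
  `|P z p| <= `|P z m|.
Proof.
move=> Dz mp; rewrite /P (big_cat_nat (leq0n m) mp) //= normrM ler_piMr //.
rewrite normr_prod prodr_ile1 // => j _.
by rewrite normr_ge0 norm_blaschke_factor_le1 //; case: (a1 j).
Qed.

(** The squared moduli of the factors at [z0] are [1 - y_j] with
    [y_j >= (1 - |a_j|) * (1 - |z0|) / 4], and the product of the [1 - y_j] being
    bounded below makes [\sum y_j] bounded. *)
Lemma blaschke_condition z0 (c : R[i]) : @unit_disc R z0 -> 0 < c ->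
    (forall m, c <= `|P z0 m|) ->
  exists M, forall m, \sum_(0 <= j < m) (1 - `|a j|) <= M.
Proof.
move=> Dz0 c0 cP.
have r1 : 0 < 1 - `|z0| by rewrite subr_gt0.
exists ((c ^+ 2)^-1 / ((1 - `|z0|) / 4)) => m.
have y01 j : 0 <= 1 - `|blaschke_factor (a j) z0| ^+ 2 <= 1.
  have [Da a0] := a1 j.
  by rewrite subr_ge0 gerBl exprn_ge0 // andbT expr_le1 // norm_blaschke_factor_le1.
rewrite ler_pdivlMr ?divr_gt0 // mulr_suml.
apply: (@le_trans _ _
    (\sum_(0 <= j < m) (1 - `|blaschke_factor (a j) z0| ^+ 2))).
  by apply: ler_sum => j _; have [Da a0] := a1 j; exact: one_sub_norm_zero_le.
have := prod_one_sub_mul_le m y01.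
under eq_bigr do rewrite subKr.
rewrite prodrXl -normr_prod -/(P z0 m) => prod_le.
rewrite -[leRHS]mul1r ler_pdivlMr ?exprn_gt0 // mulrC.
apply: le_trans prod_le; apply: ler_pM.
- by rewrite exprn_ge0 // ltW.
- by apply: sumr_ge0 => j _; case/andP: (y01 j).
- by rewrite lerXn2r ?nnegrE ?(ltW c0).
- by rewrite lerDr.
Qed.

Section Summable.
Variable M : R[i].
Hypothesis sumM : forall m, \sum_(0 <= j < m) (1 - `|a j|) <= M.

Lemma blaschke_series_cvg : cvgn (series (fun j => 1 - `|a j|)).
Proof.
have [l sl] : exists l : R[i], series (fun j => 1 - `|a j|) @ \oo --> l.
  apply: (@complex_bounded_variation_cvg _ _ M) => n.
  apply: le_trans (sumM n); apply: ler_sum => j _.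
  rewrite seriesSB ger0_norm // subr_ge0 ltW //; exact: (a1 j).1.
by apply/cvg_ex; exists l.
Qed.

(** The partial products have modulus at most one, so consecutive ones differ by
    at most [|1 - blaschke_factor (a j) z|], a summable sequence. *)
Lemma blaschke_product_cvg z : @unit_disc R z -> exists l : R[i], P z @ \oo --> l.
Proof.
move=> Dz; have z1 : 0 < 1 - `|z| by rewrite subr_gt0.
apply: (@complex_bounded_variation_cvg _ _ (M * (2 / (1 - `|z|)))) => n.
apply: (@le_trans _ _ (\sum_(0 <= j < n) (1 - `|a j|) * (2 / (1 - `|z|)))).
  apply: ler_sum => j _; have [Da a0] := a1 j.
  apply: le_trans (norm_one_sub_blaschke_factor_le Da a0 Dz).
  have -> : P z j.+1 - P z j = - (P z j * (1 - blaschke_factor (a j) z)).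
    by rewrite /P big_nat_recr //= mulrBr mulr1 opprB.
  rewrite normrN normrM ler_piMl //.
  by rewrite (le_trans (norm_partial_product_le Dz (leq0n j))) // /P big_geq // normr1.
by rewrite -mulr_suml ler_wpM2r // divr_ge0 // ltW.
Qed.
End Summable.
End InfiniteProduct.

(** * Limits of products with more and more factors *)

Lemma nondecreasing_leq (u : nat -> nat) :
  (forall n, (u n <= u n.+1)%N) -> {homo u : m n / (m <= n)%N}.
Proof. by move=> uS; apply: homo_leq => //; exact: leq_trans. Qed.

Lemma bounded_nat_stationary (u : nat -> nat) (M : nat) :
  (forall n, (u n <= u n.+1)%N) -> (forall n, (u n <= M)%N) ->
  exists N, forall n, (N <= n)%N -> u n = u N.
Proof.
move=> uS uM.
have exP : exists k, `[< exists n, u n = k >] by exists (u 0%N); apply/asboolP; exists 0%N.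
have leP k : `[< exists n, u n = k >] -> (k <= M)%N by move=> /asboolP[n <-].
case: (ex_maxnP exP leP) => k /asboolP[N uN] kmax.
exists N => n Nn; apply/eqP; rewrite eqn_leq (nondecreasing_leq uS Nn) andbT uN.
by apply: kmax; apply/asboolP; exists n.
Qed.

Lemma natr_complex_bounded (R : realType) (u : nat -> nat) (M : R[i]) :
  (forall n, (u n)%:R <= M) -> exists m : nat, forall n, (u n <= m)%N.
Proof.
move=> uM; exists (Num.bound `|complex.Re M|) => n.
have : real_complex R (u n)%:R <= M by rewrite rmorph_nat.
rewrite lecE => /andP[_ /= le]; rewrite -(ler_nat R).
by rewrite (le_trans le) // (le_trans (ler_norm _)) // ltW // archi_boundP.
Qed.

Lemma prefix_chain (T : eqType) (S : nat -> seq T) m n :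
  (forall n, prefix (S n) (S n.+1)) -> (m <= n)%N -> prefix (S m) (S n).
Proof.
move=> pS; apply: (@homo_leq _ S (fun s t => prefix s t)) => //.
- exact: prefix_refl.
- by move=> y x z; exact: prefix_trans.
Qed.

Section Chain.
Variables (R : realType) (A : nat -> R[i]) (K : nat -> nat) (S : nat -> seq R[i]).
Variables (B : R[i] -> R[i]) (z0 : R[i]).
Let f n z := A n * (z ^+ K n * \prod_(a <- S n) blaschke_factor a z).
Hypotheses (A1 : forall n, `|A n| = 1).
Hypothesis S1 : forall n a, a \in S n -> unit_disc a /\ a != 0.
Hypothesis KS : forall n, (K n <= K n.+1)%N.
Hypothesis pS : forall n, prefix (S n) (S n.+1).
Hypothesis fB : forall z, unit_disc z -> f^~ z @ \oo --> B z.
Hypotheses (Dz0 : @unit_disc R z0) (Bz0 : B z0 != 0).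

Lemma norm_chain n z :
  `|f n z| = `|z| ^+ K n * \prod_(a <- S n) `|blaschke_factor a z|.
Proof. by rewrite /f normrM A1 mul1r normrM normrX normr_prod. Qed.

Lemma norm_chain_nonincreasing n z : @unit_disc R z -> `|f n.+1 z| <= `|f n z|.
Proof.
move=> z1; rewrite !norm_chain; have /prefixP[t St] := pS n.
apply: ler_pM; rewrite ?exprn_ge0 ?prodr_ge0 //.
  by rewrite ler_wiXn2l // ltW.
rewrite St big_cat /= ler_piMr ?prodr_ge0 // prod_norm_blaschke_factor_le1 // => a at_.
by apply: (S1 (n := n.+1)); rewrite St mem_cat at_ orbT.
Qed.

Let lower := `|B z0| / 2.

Lemma lower_gt0 : 0 < lower. Proof. by rewrite divr_gt0 ?normr_gt0. Qed.

Lemma lower_le_norm_chain n : lower <= `|f n z0|.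
Proof.
by apply: (cvgn_norm_lower_bound (fB Dz0)) => m; exact: norm_chain_nonincreasing.
Qed.

(** Were [K n] unbounded, the factor [|z0| ^+ K n] would drive [|f n z0|] to
    zero. *)
Lemma origin_order_bounded : exists m, forall n, (K n <= m)%N.
Proof.
have r1 : 0 < 1 - `|z0| by rewrite subr_gt0.
apply: (@natr_complex_bounded _ _ ((lower * (1 - `|z0|))^-1)) => n.
have cr : 0 < lower * (1 - `|z0|) by apply: mulr_gt0 => //; exact: lower_gt0.
rewrite -[leRHS]mul1r ler_pdivlMr //.
have y01 (j : nat) : 0 <= 1 - `|z0| <= 1 by rewrite ltW //= gerBl.
have := prod_one_sub_mul_le (K n) y01.
rewrite !prodr_const_nat sumr_const_nat subn0 subKr; apply: le_trans.
have cK : lower <= `|z0| ^+ K n.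
  rewrite (le_trans (lower_le_norm_chain n)) // norm_chain ler_piMr ?exprn_ge0 //.
  by rewrite prod_norm_blaschke_factor_le1 // => a; exact: S1.
rewrite mulrCA mulr_natl; apply: ler_pM cK _;
  rewrite ?(ltW lower_gt0) ?mulrn_wge0 ?(ltW r1) //.
by rewrite lerDr.
Qed.

Lemma origin_order_stationary : exists N, forall n, (N <= n)%N -> K n = K N.
Proof.
by have [m Km] := origin_order_bounded; exact: (bounded_nat_stationary KS Km).
Qed.

Lemma chain_limit_finite M : (forall n, (size (S n) <= M)%N) ->
  finite_blaschke_form B.
Proof.
move=> SM.
have sS n : (size (S n) <= size (S n.+1))%N.
  by have /prefixP[t ->] := pS n; rewrite size_cat leq_addr.
have [N1 SN] := bounded_nat_stationary sS SM.
have [N2 KN] := origin_order_stationary.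
have SE n : (N1 <= n)%N -> S n = S N1.
  move=> Nn; have /prefixP[t tE] := prefix_chain pS Nn.
  have := SN _ Nn; rewrite tE size_cat => /eqP.
  by rewrite -[X in _ == X]addn0 eqn_add2l => /eqP/size0nil ->; rewrite cats0.
have gG z : @unit_disc R z ->
    (fun n => z ^+ K n * \prod_(a <- S n) blaschke_factor a z)
    @ \oo --> z ^+ K N2 * \prod_(a <- S N1) blaschke_factor a z.
  move=> _; apply: (@cvgn_eventually_eq _ _ (fun=> _) (maxn N1 N2));
    last exact: cvgn_const.
  by move=> n; rewrite geq_max => /andP[n1 n2]; rewrite SE // KN.
have [alpha alpha1 BE] :=
  unimodular_multiple_limit (D := @unit_disc R) A1 Dz0 Bz0 gG fB.
exists alpha, (K N2), (S N1); split => //; first exact: S1.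
by move=> z Dz; rewrite -mulrA; exact: BE.
Qed.

(** The [S n] being prefixes of one another, they are the initial segments of a
    single sequence [a]; along [n] the products over [S n] form a subsequence, with
    repetitions, of the partial products of [a]. *)
Lemma chain_limit_infinite : (forall m, exists n, (m < size (S n))%N) ->
  infinite_blaschke_form B.
Proof.
move=> /choice[N NS].
(* [N j] is an index from which the entry [j] exists; the default value is never
   reached. *)
pose a j := nth 0 (S (N j)) j.
have aE n j : (j < size (S n))%N -> nth 0 (S n) j = a j.
  move=> jn; rewrite /a; have [le|/ltnW le] := leqP n (N j).
    by have /prefixP[t ->] := prefix_chain pS le; rewrite nth_cat jn.
  by have /prefixP[t ->] := prefix_chain pS le; rewrite nth_cat NS.
have a1 j : unit_disc (a j) /\ a j != 0 by apply: S1 (mem_nth _ (NS j)).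
pose P z m := \prod_(0 <= j < m) blaschke_factor (a j) z.
have SP n z : \prod_(b <- S n) blaschke_factor b z = P z (size (S n)).
  rewrite (big_nth 0); apply: eq_big_nat => j /andP[_ jn].
  by rewrite aE.
have cP m : lower <= `|P z0 m|.
  rewrite (le_trans (lower_le_norm_chain (N m))) // norm_chain -normr_prod SP.
  rewrite (le_trans _ (norm_partial_product_le a1 Dz0 (ltnW (NS m)))) // ler_piMl //.
  by rewrite exprn_ile1 // ltW.
have [M sumM] := blaschke_condition a1 Dz0 lower_gt0 cP.
have Pcvg z : exists l : R[i], @unit_disc R z -> P z @ \oo --> l.
  case: (pselect (@unit_disc R z)) => [Dz|nDz]; last first.
    exists 0 => Dz; case: (nDz Dz).
  by have [l Pl] := blaschke_product_cvg a1 sumM Dz; exists l => _; exact: Pl.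
case: (choice Pcvg) => Q PQ.
have [N2 KN] := origin_order_stationary.
have size_cvg : size (S n) @[n --> \oo] --> \oo.
  apply/cvgnyPge => m; exists (N m) => // n /= Nn.
  have /prefixP[t ->] := prefix_chain pS Nn.
  by rewrite size_cat (leq_trans (ltnW (NS m))) // leq_addr.
have gG z : @unit_disc R z ->
    (fun n => z ^+ K n * \prod_(a <- S n) blaschke_factor a z)
    @ \oo --> z ^+ K N2 * Q z.
  move=> Dz.
  apply: (@cvgn_eventually_eq _ _ (fun n => z ^+ K N2 * P z (size (S n))) N2).
    by move=> n Nn; rewrite KN // SP.
  apply: cvgn_mul; first exact: cvgn_const.
  exact: (cvg_comp _ _ size_cvg (PQ z Dz)).
have [alpha alpha1 BE] :=
  unimodular_multiple_limit (D := @unit_disc R) A1 Dz0 Bz0 gG fB.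
exists alpha, (K N2), a, Q; split.
- exact: alpha1.
- exact: a1.
- exact: (blaschke_series_cvg a1 sumM).
- exact: PQ.
- by move=> z Dz; rewrite -mulrA; exact: BE.
Qed.

Lemma chain_limit : finite_blaschke_form B \/ infinite_blaschke_form B.
Proof.
have [[M SM]|nb] := pselect (exists M, forall n, (size (S n) <= M)%N).
  by left; exact: chain_limit_finite SM.
right; apply: chain_limit_infinite => m; apply: contrapT => H; apply: nb; exists m => n.
by rewrite leqNgt; apply/negP => mn; apply: H; exists n.
Qed.

End Chain.

(** * The compositions *)

Lemma locally_uniform_cvg_pointwise (T : topologicalType) (V : uniformType)
    (A : set T) (f : nat -> T -> V) (g : T -> V) x :
  locally_uniform_cvg A f g -> A x -> f^~ x @ \oo --> g x.
Proof.
move=> fg Ax; have [U Ux] := fg x Ax.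
have sub : [set x] `<=` U `&` A by move=> _ ->; split=> //; exact: nbhs_singleton.
by move=> /(uniform_subset_cvg _ sub); rewrite uniform_set1.
Qed.

Section Compositions.
Variables (R : realType) (b : nat -> R[i] -> R[i]).
Hypothesis b_disc : forall n, (0 < n)%N ->
  set_fun (@unit_disc R) (@unit_disc R) (b n).
Hypothesis b_form : forall n, (0 < n)%N -> finite_blaschke_form (b n).
Hypothesis b_fix0 : forall n, (0 < n)%N -> b n 0 = 0.

Lemma left_comp_disc n z : unit_disc z -> unit_disc (left_comp b n z).
Proof. by elim: n => // n IH z1; apply: b_disc (IH z1). Qed.

Lemma left_comp0 n : left_comp b n 0 = 0.
Proof. by elim: n => //= n ->; exact: b_fix0. Qed.

Lemma left_comp_mobius_product n : mobius_product (left_comp b n).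
Proof.
elim: n => [|n IH].
  exists 1, [:: 0]; split=> [||z z1].
  - exact: normr1.
  - by move=> a; rewrite inE => /eqP ->; rewrite normr0.
  - by rewrite big_seq1 mobius0 mul1r.
apply: mobius_product_comp IH; first exact: left_comp_disc.
exact/finite_blaschke_form_mobius_product/b_form.
Qed.

(** The quotient is [g \o left_comp b n] with [b n.+1 w = w * g w]. *)
Lemma left_comp_divides_next n : exists2 g, finite_blaschke_form g &
  forall z, unit_disc z -> left_comp b n.+1 z = left_comp b n z * g z.
Proof.
have bP := finite_blaschke_form_mobius_product (b_form (ltn0Sn n)).
have [g gP bE] := mobius_product_factor0 bP (b_fix0 (ltn0Sn n)).
exists (g \o left_comp b n).
  apply/mobius_product_finite_blaschke_form/mobius_product_comp => //.
    exact: left_comp_disc.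
  exact: left_comp_mobius_product.
by move=> z z1; rewrite /= bE //; exact: left_comp_disc.
Qed.

(** The triple [(A n, K n, S n)] accumulates the constants, the orders at the
    origin and the zeros of the successive quotients. *)
Lemma left_comp_chain : exists A K S, [/\
  forall n, `|A n| = 1 :> R[i],
  forall n a, a \in S n -> unit_disc a /\ a != 0,
  forall n, (K n <= K n.+1)%N,
  forall n, prefix (S n) (S n.+1) &
  forall n z, unit_disc z ->
    left_comp b n z = A n * (z ^+ K n * \prod_(a <- S n) blaschke_factor a z)].
Proof.
have /choice[g gP] : forall n, exists t : R[i] * nat * seq R[i],
    [/\ `|t.1.1| = 1, forall a, a \in t.2 -> unit_disc a /\ a != 0 &
      forall z, unit_disc z -> left_comp b n.+1 z = left_comp b n z *
        (t.1.1 * z ^+ t.1.2 * \prod_(a <- t.2) blaschke_factor a z)].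
  move=> n; have [g [c [k [s [c1 s1 gE]]]] bE] := left_comp_divides_next n.
  by exists (c, k, s); split=> // z z1; rewrite bE // gE.
(* The leading [1] is the zero at the origin of [left_comp b 0 = id]. *)
exists (fun n => \prod_(i < n) (g i).1.1),
  (fun n => (1 + \sum_(i < n) (g i).1.2)%N),
  (fun n => \big[cat/[::]]_(i < n) (g i).2); split.
- by move=> n; rewrite normr_prod big1 // => i _; case: (gP i).
- elim=> [a|n IH a]; first by rewrite big_ord0.
  rewrite big_ord_recr mem_cat => /orP[/IH //|]; case: (gP n) => _ + _; exact.
- by move=> n; rewrite big_ord_recr /= addnA leq_addr.
- by move=> n; rewrite big_ord_recr /= prefix_prefix.
move=> n z z1; elim: n => [|n IH].
  by rewrite !big_ord0 big_nil mul1r mulr1 expr1.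
have [_ _ ->//] := gP n; rewrite IH !big_ord_recr /= big_cat /= !exprD; ring.
Qed.
End Compositions.

Theorem theorem1p2 (R : realType) (b : nat -> R[i] -> R[i]) (B : R[i] -> R[i])
    (b_disc : forall n : nat, (0 < n)%N ->
       set_fun (@unit_disc R) (@unit_disc R) (b n))
    (b_blaschke : forall n : nat, (0 < n)%N -> finite_blaschke (b n))
    (b_fix0 : forall n : nat, (0 < n)%N -> b n 0 = 0)
    (B_disc : set_fun (@unit_disc R) (@unit_disc R) B)
    (B_cvg : locally_uniform_cvg (@unit_disc R) (left_comp b) B) :
  constant_on (@unit_disc R) B \/ blaschke B.
Proof.
have [[z0 Dz0 Bz0]|B0] := pselect (exists2 z, @unit_disc R z & B z != 0); last first.
  left; exists 0 => z Dz; apply: contrapT => /eqP Bz; apply: B0.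
  exists z; [exact: Dz|exact: Bz].
right.
have b_form n : (0 < n)%N -> finite_blaschke_form (b n).
  by move=> n0; case: (b_blaschke n n0).
have [A [K [S [A1 S1 KS pS bE]]]] := left_comp_chain b_disc b_form b_fix0.
have Bcvg z : @unit_disc R z -> left_comp b n z @[n --> \oo] --> B z.
  exact: (locally_uniform_cvg_pointwise B_cvg).
split.
  apply: (chain_limit A1 S1 KS pS _ Dz0 Bz0) => z Dz.
  apply: (@cvgn_eventually_eq _ _ (fun n => left_comp b n z) 0%N); last exact: Bcvg.
  by move=> n _; rewrite bE.
exists 0; first by rewrite /unit_disc /= normr0 ltr01.
apply: (@cvgn_unique _ (fun n => left_comp b n 0)).
  by apply: Bcvg; rewrite /unit_disc /= normr0 ltr01.
apply: (@cvgn_eventually_eq _ _ (fun=> 0) 0%N); last exact: cvgn_const.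
by move=> n _; exact: left_comp0.
Qed.
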